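(* Let $q$ be a prime power and let $k,u,h$ be positive integers with $u\ge 2$, $k\ge hu$, $q^k-q^{k-1}>h(q^u-1)$ and $i_h+u>\sum_{i=1}^{k-u}\lfloor h/q^i\rfloor$. For $i=1,\dots,h$ let $U_i=\langle \mathbf e_{(i-1)u+1},\dots,\mathbf e_{iu}\rangle\subseteq\mathbf F_q^k$, where $\mathbf e_j$ is the $j$-th standard basis vector. Let $U$ be the set of nonzero vectors of $\mathbf F_q^k$ not lying in $U_1\cup\cdots\cup U_h$, let $\widetilde G$ be a $k\times\frac{|U|}{q-1}$ matrix whose columns consist of exactly one representative of each class $\{\lambda\mathbf v:\lambda\in\mathbf F_q^*\}$, $\mathbf v\in U$, and let $\mathbf C_1$ be the linear code over $\mathbf F_q$ with generator matrix $\widetilde G$. Then $\mathbf C_1$ is a distance-optimal linear $[n,k,d]_q$ code with $$n=\frac{(q^k-1)-h(q^u-1)}{q-1},\qquad d=q^{k-1}-hq^{u-1},$$ and: (a) the weight distribution of $\mathbf C_1$ is: weight $0$ with multiplicity $1$; weight $q^{k-1}$ with multiplicity $q^{k-hu}-1$; and, for each $j=1,\dots,h$, weight $q^{k-1}-jq^{u-1}$ with multiplicity $\binom{h}{j}(q^u-1)^{j}q^{k-hu}$ (so weight $q^{k-1}-hq^{u-1}$ has multiplicity $(q^u-1)^hq^{k-hu}$, weight $q^{k-1}-(h-1)q^{u-1}$ has multiplicity $h(q^u-1)^{h-1}q^{k-hu}$, ..., weight $q^{k-1}-q^{u-1}$ has multiplicity $h(q^u-1)q^{k-hu}$); (b)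 the generalized Hamming weights of $\mathbf C_1$ are $$d_r(\mathbf C_1)=\begin{cases}\dfrac{(q^k-q^{k-r})-h(q^u-q^{u-r})}{q-1}, & 1\le r\le u,\\[2mm] \dfrac{(q^k-q^{k-r})-h(q^u-1)}{q-1}, & u\le r\le k.\end{cases}$$
   Context: For a positive integer $h$ with $q$-adic expansion $h=h_{m-1}q^{m-1}+\dots+h_0$ ($0\le h_i<q$), $i_h$ denotes the least index $i\ge 0$ with $h_i>0$. A linear $[n,k,d]_q$ code is distance optimal if no linear $[n,k,d+1]_q$ code exists. The weight distribution lists, for each weight $w$, the number of codewords of Hamming weight $w$. The support of a subcode $D$ is the set of coordinates where some codeword of $D$ is nonzero; the $r$-th generalized Hamming weight $d_r(\mathbf C)$ is the minimum support size of an $r$-dimensional subcode of $\mathbf C$. *)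

(* Defs.v *)
From HB Require Import structures.
From mathcomp Require Import all_boot all_order all_algebra.
Set Implicit Arguments. Unset Strict Implicit. Unset Printing Implicit Defensive.
Import GRing.Theory.
Local Open Scope ring_scope.

Section Codes.
Variable F : finFieldType.

Definition wt n (c : 'rV[F]_n) : nat := #|[set j : 'I_n | c ord0 j != 0]|.

Definition supp n (D : {vspace 'rV[F]_n}) : {set 'I_n} :=
  [set j : 'I_n | [exists c : 'rV[F]_n, (c \in D) && (c ord0 j != 0)]].

Definition min_dist n (C : {vspace 'rV[F]_n}) (d : nat) : Prop :=
  (exists c, c \in C /\ c != 0 /\ wt c = d) /\
  (forall c, c \in C -> c != 0 -> (d <= wt c)%N).

Definition distance_optimal n (C : {vspace 'rV[F]_n}) : Prop :=
  forall d, min_dist C d ->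
    ~ exists C' : {vspace 'rV[F]_n}, \dim C' = \dim C /\ min_dist C' d.+1.

Definition is_ghw n (C : {vspace 'rV[F]_n}) (r w : nat) : Prop :=
  (exists D : {vspace 'rV[F]_n}, (D <= C)%VS /\ \dim D = r /\ #|supp D| = w) /\
  (forall D : {vspace 'rV[F]_n}, (D <= C)%VS -> \dim D = r -> (w <= #|supp D|)%N).

(* U_i = < e_{(i-1)u+1}, ..., e_{iu} > (1-based), i.e. 0-based indices
   (i-1)u <= j < iu *)
Definition Ublock k (u i : nat) : {vspace 'rV[F]_k} :=
  (\sum_(j < k | ((i.-1 * u <= j) && (j < i * u))%N) <[delta_mx ord0 j]>)%VS.

Definition Uset k (u h : nat) : {set 'rV[F]_k} :=
  [set v : 'rV[F]_k | (v != 0) &&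
     ~~ [exists i : 'I_h, v \in Ublock k u i.+1]].

Definition rowcode k n (G : 'M[F]_(k, n)) : {vspace 'rV[F]_n} :=
  (\sum_(i < k) <[row i G]>)%VS.

End Codes.

Definition qdigit (q h i : nat) : nat := (h %/ q ^ i) %% q.

Definition is_ih (q h i : nat) : Prop :=
  qdigit q h i != 0%N /\ forall i', (i' < i)%N -> qdigit q h i' = 0%N.

(* Main.v *)
(* The word [a *m G] vanishes at the column [g] iff [a] is orthogonal to [g]. Hence
   the support of the subcode with message space spanned by the rows of [B] has
   size [(q-1)^-1] times the number of [v] in [U] with [B v <> 0]; counting over
   [F^k] and over each [U_i] gives
     (q^k - q^(k - rank B)) - sum_i (q^u - q^(u - rank B_i)),
   where [B_i] is the part of [B] in the columns of block [i]. For [B] a single row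
   this is the weight of a word, determined by the number of nonzero blocks of the
   message; for [B] of rank [r] it is minimal when every [B_i] has rank [min(r, u)],
   which is achieved by starting from the diagonal copy of [F^u] in the blocks.
   Optimality is Griesmer's bound: the sum of the [ceil ((d + 1) / q^i)], i < k,
   equals [n + i_h + u - sum_i floor (h / q^i)], which exceeds [n]. *)

Require Import Defs.
From HB Require Import structures.
From mathcomp Require Import all_boot all_order all_algebra.
From mathcomp Require Import finfield mxabelem zify.
Set Implicit Arguments. Unset Strict Implicit. Unset Printing Implicit Defensive.
Import GRing.Theory.
Local Open Scope ring_scope.

(** * Row spaces of matrices as codes: dimension, support, annihilator *)

Section RowCode.
Variable F : finFieldType.
Local Notation q := #|F|.

Lemma mem_rowcode m n (M : 'M[F]_(m, n)) (c : 'rV[F]_n) :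
  (c \in rowcode M) = (c <= M)%MS.
Proof.
apply/memv_sumP/submxP => [[v vP ->] | [a ->]].
  have /fin_all_exists [b bP] i : exists b : F, v i = b *: row i M.
    by have /vlineP [b ->] := vP i isT; exists b.
  exists (\row_i b i); rewrite mulmx_sum_row.
  by apply: eq_bigr => i _; rewrite bP mxE.
exists (fun i => a 0 i *: row i M) => [i _|]; last by rewrite mulmx_sum_row.
by apply/vlineP; exists (a 0 i).
Qed.

(** Dimension and rank are both the exponent of [q] in the number of words. *)
Lemma dim_rowcode m n (M : 'M[F]_(m, n)) : \dim (rowcode M) = \rank M.
Proof.
apply/eqP; rewrite -(eqn_exp2l _ _ (card_finNzRing_gt1 F)); apply/eqP.
rewrite -card_vspace -card_rowg; apply: eq_card => c.
by rewrite inE mem_rowcode.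
Qed.

Lemma rowcodeS m p n (M : 'M[F]_(m, n)) (N : 'M[F]_(p, n)) :
  (rowcode M <= rowcode N)%VS = (M <= N)%MS.
Proof.
apply/subvP/row_subP => [MN i | MN c].
  by rewrite -mem_rowcode MN // mem_rowcode row_sub.
by rewrite !mem_rowcode => cM; apply: submx_trans cM _; apply/row_subP.
Qed.

Lemma rowcode_onto n (D : {vspace 'rV[F]_n}) :
  exists M : 'M[F]_(\dim D, n), D = rowcode M.
Proof.
exists (\matrix_i (vbasis D)`_i).
rewrite /rowcode -[LHS](span_basis (vbasisP D)) span_def big_tuple.
by apply: eq_bigr => i _; rewrite rowK (tnth_nth 0).
Qed.

Lemma in_supp_rowcode m n (M : 'M[F]_(m, n)) j :
  (j \in supp (rowcode M)) = (col j M != 0).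
Proof.
rewrite inE; apply/existsP/idP => [[c /andP[]] | /cV0Pn [i]].
  rewrite mem_rowcode => /submxP [a ->]; apply: contra => /eqP M0.
  rewrite mxE big1 // => i _.
  by have := congr1 (fun v : 'cV_m => v i ord0) M0; rewrite !mxE => ->; rewrite mulr0.
by rewrite mxE => Mij; exists (row i M); rewrite mem_rowcode row_sub mxE.
Qed.

(** Makes a weight the one-row case of a support size, so that one count serves both the weight
    distribution and the generalized weights. *)
Lemma wt_supp n (c : 'rV[F]_n) : wt c = #|supp (rowcode c)|.
Proof.
apply: eq_card => j; rewrite in_supp_rowcode inE.
apply/idP/idP => [cj | /cV0Pn [i]]; last by rewrite mxE ord1.
by apply/cV0Pn; exists ord0; rewrite mxE.
Qed.

Lemma rank_rV n (v : 'rV[F]_n) : \rank v = (v != 0).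
Proof.
have [->|v0] := eqVneq v 0; first by rewrite mxrank0.
by apply/eqP; rewrite eqn_leq rank_leq_row lt0n mxrank_eq0.
Qed.

Lemma card_annihilator m n (B : 'M[F]_(m, n)) :
  #|[set v : 'rV[F]_n | B *m v^T == 0]| = (q ^ (n - \rank B))%N.
Proof.
rewrite -(mxrank_tr B) -mxrank_ker -card_rowg; apply: eq_card => v.
by rewrite !inE sub_kermx -trmx_eq0 trmx_mul trmxK.
Qed.

Lemma card_non_annihilator m n (B : 'M[F]_(m, n)) :
  #|[set v : 'rV[F]_n | B *m v^T != 0]| = (q ^ n - q ^ (n - \rank B))%N.
Proof.
rewrite -(card_annihilator B).
have -> : (q ^ n)%N = #|{: 'rV[F]_n}| by rewrite card_mx mul1n.
rewrite -(cardsC [set v : 'rV[F]_n | B *m v^T == 0]) addKn.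
by apply: eq_card => v; rewrite !inE.
Qed.

End RowCode.

(** * Counting the vectors outside the blocks *)

Section Blocks.
Variables (F : finFieldType) (k u h : nat).
Local Notation q := #|F|.
Hypothesis huk : (h * u <= k)%N.

(* [w *m block_incl i] places [w] on the coordinates of the [i]-th block, and
   [a *m (block_incl i)^T] reads that block off [a]. *)
Definition block_incl (i : nat) : 'M[F]_(u, k) :=
  \matrix_(t, j) ((j : nat) == i * u + t)%N%:R.


Lemma block_bound (i : 'I_h) (t : 'I_u) : (i * u + t < k)%N.
Proof.
have : (i.+1 * u <= h * u)%N by rewrite leq_mul2r ltn_ord orbT.
by have := ltn_ord t; rewrite mulSn; lia.
Qed.

Definition block_pos (i : 'I_h) (t : 'I_u) : 'I_k := Ordinal (block_bound i t).

Lemma block_pos_inj i i' t t' : block_pos i t = block_pos i' t' -> i = i' /\ t = t'.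
Proof.
move=> /(congr1 val) /= E; have u0 : (0 < u)%N by apply: leq_trans (ltn_ord t).
split; apply: val_inj => /=.
  by have := congr1 (divn^~ u) E; rewrite /= !divnMDl // !divn_small // !addn0.
by have := congr1 (modn^~ u) E; rewrite /= !modnMDl !modn_small.
Qed.

Lemma row_block_incl (i : 'I_h) t : row t (block_incl i) = delta_mx 0 (block_pos i t).
Proof. by apply/rowP => j; rewrite !mxE. Qed.

Lemma mul_block_incl_tr m (B : 'M[F]_(m, k)) (i : 'I_h) r t :
  (B *m (block_incl i)^T) r t = B r (block_pos i t).
Proof.
rewrite mxE (bigD1 (block_pos i t)) //= big1 => [|j].
  by rewrite !mxE eqxx mulr1 addr0.
by rewrite -val_eqE !mxE /= => /negPf ->; rewrite mulr0.
Qed.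

Lemma block_inclK (i : 'I_h) : block_incl i *m (block_incl i)^T = 1%:M.
Proof.
apply/matrixP => t t'; rewrite mul_block_incl_tr !mxE /= eqn_add2l.
by rewrite eq_sym val_eqE eq_sym.
Qed.

Lemma block_incl_orth (i i' : 'I_h) :
  i != i' -> block_incl i *m (block_incl i')^T = 0.
Proof.
move=> ii'; apply/matrixP => t t'; rewrite mul_block_incl_tr !mxE.
case: eqP => // /(@val_inj _ _ _ (block_pos i' t') (block_pos i t)) /block_pos_inj [E _].
by rewrite E eqxx in ii'.
Qed.

Lemma Ublock_rowcode (i : 'I_h) : Ublock F k u i.+1 = rowcode (block_incl i).
Proof.
apply/eqP; rewrite eqEsubv; apply/andP; split.
  apply/subv_sumP => j /andP[/= j1 j2].
  have jt : (j - i * u < u)%N by rewrite mulSn in j2; lia.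
  rewrite -memvE mem_rowcode.
  rewrite (_ : delta_mx _ _ = row (Ordinal jt) (block_incl i)) ?row_sub //.
  rewrite row_block_incl; congr delta_mx; apply: val_inj => /=; lia.
apply/subv_sumP => t _; rewrite row_block_incl.
apply: (sumv_sup (block_pos i t)) => //=.
by rewrite leq_addr /= mulSn addnC ltn_add2r.
Qed.

Lemma mem_Ublock (i : 'I_h) v :
  reflect (exists w, v = w *m block_incl i) (v \in Ublock F k u i.+1).
Proof. by rewrite Ublock_rowcode mem_rowcode; apply: submxP. Qed.

Lemma Ublock_disjoint (i i' : 'I_h) v :
  v \in Ublock F k u i.+1 -> v \in Ublock F k u i'.+1 -> v != 0 -> i = i'.
Proof.
move=> /mem_Ublock [w ->] /mem_Ublock [w' E]; apply: contra_neq_eq => ii'.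
have := congr1 (fun x => x *m (block_incl i)^T) E.
rewrite -!mulmxA block_inclK block_incl_orth 1?eq_sym // mulmx1 mulmx0 => ->.
by rewrite mul0mx.
Qed.

(** [block_incl i] maps [F^u] bijectively onto the block and turns [B] into
    [B *m (block_incl i)^T]. *)
Lemma card_Ublock_non_annihilator m (B : 'M[F]_(m, k)) (i : 'I_h) :
  #|[set v | (B *m v^T != 0) && (v \in Ublock F k u i.+1)]|
  = (q ^ u - q ^ (u - \rank (B *m (block_incl i)^T)))%N.
Proof.
rewrite -card_non_annihilator -(card_imset _ (row_free_inj _ (A := block_incl i))); last first.
  by apply/row_freeP; exists (block_incl i)^T; apply: block_inclK.
apply: eq_card => v; rewrite inE; apply/andP/imsetP.
  by move=> [Bv /mem_Ublock [w E]]; exists w; rewrite // inE -mulmxA -trmx_mul -E.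
move=> [w]; rewrite inE -mulmxA -trmx_mul => Bw ->; split=> //.
by apply/mem_Ublock; exists w.
Qed.

(** Blocks meet only in 0, so a vector satisfying [P] lies in at most one of them. The sum stays on
    the left to avoid truncated subtraction. *)
Lemma card_Uset_split (P : pred 'rV[F]_k) : ~~ P 0 ->
  (#|[set v in Uset F k u h | P v]|
   + \sum_(i < h) #|[set v | P v && (v \in Ublock F k u i.+1)]| = #|[set v | P v]|)%N.
Proof.
move=> P0.
have -> : (\sum_(i < h) #|[set v | P v && (v \in Ublock F k u i.+1)]| =
    #|[set v | P v && [exists i : 'I_h, v \in Ublock F k u i.+1]]|)%N.
  have cardE (Q : pred 'rV[F]_k) : #|[set v | Q v]| = (\sum_v Q v)%N.
    by rewrite -sum1_card big_mkcond; apply: eq_bigr => v _; rewrite inE; case: (Q v).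
  under eq_bigr => i _ do rewrite cardE.
  rewrite cardE exchange_big /=.
  apply: eq_bigr => v _.
  have [Pv /=|Pv] := boolP (P v); last by rewrite big1.
  have [/existsP [i vi]|/existsPn vN] :=
    boolP [exists i : 'I_h, v \in Ublock F k u i.+1]; last first.
    by rewrite big1 // => i _; rewrite (negPf (vN i)).
  rewrite (bigD1 i) //= vi big1 // => j ji; case: (boolP (v \in _)) => // vj.
  have v0 : v != 0 by apply: contraNneq P0 => <-.
  by rewrite (Ublock_disjoint vi vj v0) eqxx in ji.
rewrite -[RHS](cardsID (Uset F k u h)); congr (_ + _)%N; apply: eq_card => v.
  by rewrite !inE andbC.
rewrite !inE; case Pv: (P v); rewrite ?andbF //= andbT.
have -> : v != 0 by apply: contraNneq P0 => <-.
by rewrite negbK.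
Qed.

Lemma card_Uset_non_annihilator m (B : 'M[F]_(m, k)) :
  (#|[set v in Uset F k u h | B *m v^T != 0%R]|
   + \sum_(i < h) (q ^ u - q ^ (u - \rank (B *m (block_incl i)^T)))
   = q ^ k - q ^ (k - \rank B))%N.
Proof.
rewrite -card_non_annihilator -(card_Uset_split (P := fun v => B *m v^T != 0)).
  by congr (_ + _)%N; apply: eq_bigr => i _; rewrite card_Ublock_non_annihilator.
by rewrite trmx0 mulmx0 eqxx.
Qed.

Lemma rank_block_incl (i : 'I_h) : \rank (block_incl i) = u.
Proof. by apply/eqP/row_freeP; exists (block_incl i)^T; apply: block_inclK. Qed.

Lemma card_Uset : (#|Uset F k u h| + h * (q ^ u - 1) = q ^ k - 1)%N.
Proof.
have := card_Uset_non_annihilator 1%:M; rewrite mxrank1 subnn expn0 => <-.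
congr (_ + _)%N; last first.
  rewrite -[h in LHS]card_ord -sum_nat_const; apply: eq_bigr => i _.
  by rewrite mul1mx mxrank_tr rank_block_incl subnn.
apply: eq_card => v; rewrite !inE mul1mx trmx_eq0.
by case: (v == 0); rewrite ?andbT.
Qed.

Lemma Uset_neq0 v : v \in Uset F k u h -> v != 0.
Proof. by rewrite inE => /andP[]. Qed.

Lemma Uset_scale a v : a != 0 -> v \in Uset F k u h -> a *: v \in Uset F k u h.
Proof.
move=> a0; rewrite !inE scaler_eq0 (negPf a0) => /andP[-> vN] /=.
apply: contra vN => /existsP [i vi]; apply/existsP; exists i.
by rewrite -(scale1r v) -(mulVf a0) -scalerA memvZ.
Qed.

(** * From vectors of [U] to columns of [G] *)

Section Representatives.
Variables (n : nat) (G : 'M[F]_(k, n)).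
Hypothesis GU : forall j : 'I_n, (col j G)^T \in Uset F k u h.
Hypothesis Grep : forall v, v \in Uset F k u h ->
  exists! j : 'I_n, exists a : F, (col j G)^T = a *: v.

(** Scaling gives a bijection from pairs of a nonzero scalar and a selected column to the vectors
    counted. *)
Lemma card_representatives m (B : 'M[F]_(m, k)) :
  (#|[set v in Uset F k u h | B *m v^T != 0%R]|
   = q.-1 * #|[set j | B *m col j G != 0%R]|)%N.
Proof.
pose f (x : F * 'I_n) := x.1 *: (col x.2 G)^T.
have -> : q.-1 = #|[set a : F | a != 0]|.
  by rewrite -(cardC1 (0 : F)); apply: eq_card => a; rewrite !inE.
rewrite -cardsX -[RHS](card_in_imset (f := f)) => [|x y].
  apply: eq_card => v; rewrite inE; apply/andP/imsetP => [[vU Bv] | [[a j] aj ->]].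
    have [j [[a E] _]] := Grep vU.
    (* [Grep] allows any scalar; zero is excluded because columns lie in [U]. *)
    have a0 : a != 0.
      by apply: contraNneq (Uset_neq0 (GU j)) => a0; rewrite E a0 scale0r.
    have Ev : v = a^-1 *: (col j G)^T by rewrite E scalerA mulVf // scale1r.
    exists (a^-1, j) => //; rewrite inE /= !inE invr_eq0 a0 /=.
    by apply: contra Bv => /eqP Bj; rewrite Ev linearZ /= trmxK -scalemxAr Bj scaler0.
  have [a0 Bj] : a != 0 /\ B *m col j G != 0 by move: aj; rewrite !inE => /andP.
  split; first exact: Uset_scale.
  by rewrite /f linearZ /= trmxK -scalemxAr scaler_eq0 negb_or a0.
case: x y => [a j] [b l]; rewrite !inE /= /f /= => /andP[a0 _] /andP[b0 _] E.
(* Columns [j] and [l] both represent the vector [a *: (col j G)^T], so uniqueness identifies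
   them. *)
have [i [_ iP]] := Grep (Uset_scale a0 (GU j)).
have Ej : i = j by apply: iP; exists a^-1; rewrite scalerA mulVf // scale1r.
have El : i = l by apply: iP; exists b^-1; rewrite E scalerA mulVf // scale1r.
rewrite -{}El {}Ej in E *; congr pair; apply/eqP; rewrite -subr_eq0.
have /eqP : (a - b) *: (col j G)^T = 0 by rewrite scalerBl E subrr.
by rewrite scaler_eq0 (negPf (Uset_neq0 (GU j))) orbF.
Qed.

Lemma card_supp_subcode m (B : 'M[F]_(m, k)) :
  (q.-1 * #|supp (rowcode (B *m G))|
   + \sum_(i < h) (q ^ u - q ^ (u - \rank (B *m (block_incl i)^T)))
   = q ^ k - q ^ (k - \rank B))%N.
Proof.
rewrite -card_Uset_non_annihilator card_representatives.
congr (_ * _ + _)%N; apply: eq_card => j; rewrite in_supp_rowcode inE.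
by rewrite !colE mulmxA.
Qed.

End Representatives.
End Blocks.

(** * Griesmer's bound through residual codes *)

Section Griesmer.
Variables (F : finFieldType) (n : nat).
Local Notation q := #|F|.
Implicit Types (c x : 'rV[F]_n) (J : {set 'I_n}) (D : {vspace 'rV[F]_n}).

Let wt_on J c := #|[set j in J | c ord0 j != 0]|.

(** Sum the weights of [x - a *: c] over all [a]. A coordinate where [c] vanishes counts 0 or [q]
    times; any other counts at most [q - 1] times, as [a = x_j / c_j] kills it. Hence [q * w] is at
    most [q] times the residual weight plus [w * (q - 1)]. *)
Lemma wt_on_residual J c x w :
  wt_on J c = w -> (forall a, w <= wt_on J (x - a *: c)%R)%N ->
  (w <= wt_on [set j in J | c ord0 j == 0%R] x * q)%N.
Proof.
move=> wc wx; have q1 := card_finNzRing_gt1 F.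
have wtE K y : wt_on K y = (\sum_(j in K) (y ord0 j != 0%R))%N.
  rewrite /wt_on -sum1_card big_mkcond [RHS]big_mkcond; apply: eq_bigr => j _.
  by rewrite inE; case: (j \in K) (y 0 j == 0) => [] [].
have : (\sum_(a : F) w <= \sum_(a : F) wt_on J (x - a *: c)%R)%N by apply: leq_sum.
under [X in (_ <= X)%N -> _]eq_bigr do rewrite wtE.
rewrite sum_nat_const exchange_big /= (bigID (fun j => c ord0 j == 0)) /=.
have -> : (\sum_(j in J | c ord0 j == 0%R) \sum_(a : F) ((x - a *: c)%R ord0 j != 0%R) =
    q * wt_on [set j in J | c ord0 j == 0%R] x)%N.
  rewrite wtE big_distrr /=; apply: eq_big => [j|j /andP[_ /eqP cj]]; first by rewrite inE.
  rewrite -sum_nat_const; apply: eq_bigr => a _.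
  by rewrite !mxE cj mulr0 subr0.
have : (\sum_(j in J | c ord0 j != 0%R) \sum_(a : F) ((x - a *: c)%R ord0 j != 0%R) <=
    w * q.-1)%N.
  have -> : (w * q.-1 = \sum_(j in J | c ord0 j != 0%R) q.-1)%N.
    by rewrite -wc -sum_nat_const; apply: eq_bigl => j; rewrite inE.
  apply: leq_sum => j /andP[_ cj].
  rewrite (bigD1 (x ord0 j / c ord0 j)) //= !mxE divfK // subrr eqxx add0n.
  by rewrite -(cardC1 (x ord0 j / c ord0 j)) -sum1_card; apply: leq_sum => a _; case: eqP.
set A := (\sum_(_ in _ | _) _)%N; set B := wt_on _ _.
by case: q q1 => // p _ /=; nia.
Qed.

(* The induction passes from a code to its residual code with respect to a
   word of minimal weight; working with the weight on a set of coordinates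
   keeps all the residual codes in the same ambient space. *)
Lemma griesmer_on J D d :
  (forall c, c \in D -> c != 0 -> (d < wt_on J c)%N) ->
  (\sum_(i < \dim D) (d %/ q ^ i).+1 <= #|J|)%N.
Proof.
have q0 : (0 < q)%N := ltnW (card_finNzRing_gt1 F).
move Em : (\dim D) => m; elim: m J D d Em => [|m IHm] J D d dimD dD.
  by rewrite big_ord0.
have D0 : D != 0%VS by rewrite -dimv_eq0 dimD.
pose P c := (c \in D) && (c != 0).
have P0 : P (vpick D) by rewrite /P memv_pick vpick0.
have [c /andP[cD c0] cmin] := arg_minnP (wt_on J) P0.
pose J' := [set j in J | c ord0 j == 0%R].
(* A complement of the line of [c] in [D] stands for the residual code. *)
have dimD' : \dim (D :\: <[c]>) = m.
  have := dimv_cap_compl D <[c]>; rewrite dimD (capv_idPr _) -?memvE //.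
  by rewrite dim_vline c0 => -[].
have := IHm J' _ (d %/ q)%N dimD' _.
have -> : #|J| = (wt_on J c + #|J'|)%N.
  rewrite -(cardsID [set j | c ord0 j == 0%R] J) addnC; congr (_ + _)%N.
    by apply: eq_card => j; rewrite !inE andbC.
  by apply: eq_card => j; rewrite !inE.
move=> IH; rewrite big_ord_recl divn1; apply: leq_add; first exact: dD.
rewrite (eq_bigr (fun i : 'I_m => ((d %/ q) %/ q ^ i).+1)) => [|i _]; last first.
  by rewrite -divnMA -expnS.
apply: IH => x xD' x0; rewrite ltn_divLR //.
apply: leq_trans (dD c cD c0) _; apply: wt_on_residual => // a.
have xD : x \in D := subvP (diffvSl _ _) _ xD'.
(* Minimality of [c] applies to [x - a *: c]: were it 0, [x] would lie in both the line and its
   complement. *)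
apply: cmin; rewrite /P rpredB ?rpredZ //= subr_eq0.
apply: contra x0 => /eqP xa; rewrite -memv0 -(capv_diff D <[c]>) memv_cap xD'.
by rewrite xa memvZ ?memv_line.
Qed.

(** [(d %/ q ^ i).+1] is the ceiling of [(d + 1) / q ^ i]. *)
Lemma griesmer D d :
  min_dist D d.+1 -> (\sum_(i < \dim D) (d %/ q ^ i).+1 <= n)%N.
Proof.
move=> [_ dD]; suff : (\sum_(i < \dim D) (d %/ q ^ i).+1 <= #|[set: 'I_n]|)%N.
  by rewrite cardsT card_ord.
apply: griesmer_on => c cD c0; apply: leq_trans (dD c cD c0) _.
by apply: subset_leq_card; apply/subsetP => j; rewrite !inE.
Qed.

End Griesmer.

(** * Arithmetic of the Griesmer sum and of the digits of [h] *)

Lemma rev_geometric_sum q m : (\sum_(i < m) q ^ (m - i.+1) = \sum_(i < m) q ^ i)%N.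
Proof.
by rewrite (reindex_inj rev_ord_inj); apply: eq_bigr => i _ /=; rewrite subnSK ?subKn // ltnW.
Qed.

Lemma sum_leq_ord_bound m a : (a <= m)%N -> (\sum_(i < m) (a <= i) = m - a)%N.
Proof.
elim: m => [|m IHm] am; first by rewrite big_ord0; lia.
rewrite big_ord_recr /=; case: (leqP a m) => [am' | ?]; first by rewrite IHm //; lia.
rewrite big1 => [|i _]; first by lia.
by have := ltn_ord i; case: (leqP a i) => //; lia.
Qed.

(* The [i]-th Griesmer summand of [d + 1] is at least [q ^ (k - i.+1) + 1]
   minus [h q ^ (u - i.+1)], respectively minus the ceiling of [h / q ^ (i.+1 - u)];
   that ceiling exceeds the floor exactly when [i.+1 - u] is larger than [a]. *)
Lemma griesmer_sum_gt q k u h n a :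
  (1 < q)%N -> (0 < u <= k)%N -> (h < q ^ (k - u))%N -> (0 < h)%N ->
  (q ^ a %| h)%N ->
  (\sum_(1 <= i < (k - u).+1) h %/ q ^ i < a + u)%N ->
  (n + h * \sum_(i < u) q ^ i = \sum_(i < k) q ^ i)%N ->
  (n < \sum_(i < k) ((q ^ k.-1 - h * q ^ u.-1) %/ q ^ i).+1)%N.
Proof.
move=> q1 /andP[u0 uk]; have q0 : (0 < q)%N := ltnW q1.
rewrite -(subnKC uk); set m := (k - u)%N; rewrite addKn => hm h0 qah sumh nE.
have am : (a <= m)%N by rewrite -(leq_exp2l _ _ q1) ltnW // (leq_ltn_trans (dvdn_leq h0 qah)).
rewrite big_add1 big_mkord /= in sumh.
set d := (_ - _)%N.
have low (i : 'I_u) :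
    (q ^ (u + m - i.+1) + 1 <= (d %/ q ^ i).+1 + h * q ^ (u - i.+1))%N.
  have iu := ltn_ord i.
  (* As [i < u], the division of [d] by [q ^ i] is exact. *)
  have -> : d = ((q ^ (u + m - i.+1) - h * q ^ (u - i.+1)) * q ^ i)%N.
    rewrite mulnBl -mulnA -!expnD; congr (q ^ _ - h * q ^ _)%N; lia.
  by rewrite mulnK ?expn_gt0 ?q0 //; lia.
have high (s : 'I_m) :
    (q ^ (u + m - (u + s).+1) + 1 <=
     (d %/ q ^ (u + s)).+1 + (h %/ q ^ s.+1 + (a <= s)))%N.
  have sm := ltn_ord s.
  (* The common factor [q ^ u.-1] cancels, leaving [(q ^ m - h) %/ q ^ s.+1]. *)
  have -> : d = (q ^ u.-1 * (q ^ m - h))%N.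
    by rewrite mulnBr -expnD mulnC; congr (q ^ _ - _)%N; first lia; rewrite mulnC.
  have -> : (q ^ (u + s) = q ^ u.-1 * q ^ s.+1)%N by rewrite -expnD; congr expn; lia.
  rewrite divnMl ?expn_gt0 ?q0 //; have -> : (u + m - (u + s).+1 = m - s.+1)%N by lia.
  rewrite addn1 addSn ltnS -leq_subLR addnC leq_subLR addnC.
  rewrite -leq_subLR leq_divRL ?expn_gt0 ?q0 // mulnBl -expnD subnK //.
  apply: leq_sub2l; rewrite mulnDl.
  have [_|sa] := leqP a s; last by rewrite mul0n divnK // (dvdn_trans (dvdn_exp2l _ sa)).
  by rewrite mul1n {1}(divn_eq h (q ^ s.+1)) addnC leq_add2r ltnW // ltn_mod expn_gt0 q0.
(* Added up, the bounds make the Griesmer sum at least [n + (u + m) - (m - a)] minus the floors,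
   that is [n + u + a] minus the floors; [sumh] makes this exceed [n]. *)
have Slow := leq_sum (P := xpredT) (index_enum _) (fun i _ => low i).
have Shigh := leq_sum (P := xpredT) (index_enum _) (fun s _ => high s).
move: nE (rev_geometric_sum q (u + m)); rewrite -(rev_geometric_sum q u).
rewrite !big_split_ord /=.
move: Slow Shigh; rewrite !big_split /= !sum_nat_const !card_ord sum_leq_ord_bound //.
rewrite -big_distrr /=.
lia.
Qed.

(** If the first [h] digits all vanished, [q ^ h] would divide [h], although [h < q ^ h]. *)
Lemma is_ih_exists q h : (1 < q)%N -> (0 < h)%N ->
  exists2 a, is_ih q h a & (q ^ a %| h)%N.
Proof.
move=> q1 h0.
have dvd a : (forall i, (i < a)%N -> qdigit q h i = 0%N) -> (q ^ a %| h)%N.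
  elim: a => [|a IHa] Ha; first exact: dvd1n.
  have qah : (q ^ a %| h)%N by apply: IHa => i ia; apply: Ha; apply: ltnW.
  rewrite expnS -dvdn_divRL // /dvdn; exact/eqP/Ha.
have ex : exists a, qdigit q h a != 0%N.
  case: (boolP [exists a : 'I_h, qdigit q h a != 0%N]) => [/existsP [a ?]|]; first by exists a.
  move=> /existsPn Hn; have /dvdn_leq : (q ^ h %| h)%N.
    by apply: dvd => i ih; have := Hn (Ordinal ih); rewrite negbK => /eqP.
  by move=> /(_ h0); rewrite leqNgt ltn_expl.
have [a aP amin] := ex_minnP ex.
have a0 i : (i < a)%N -> qdigit q h i = 0%N.
  by move=> ia; apply/eqP; apply: contraTT ia => /amin; rewrite -leqNgt.
by exists a; [split | apply: dvd].
Qed.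

(** * Auxiliary facts: functions of given support size, extension of subspaces, uniqueness of the
    distance *)

Lemma card_ffun_support (I T : finType) (t0 : T) j :
  #|[set f : {ffun I -> T} | #|[set i | f i != t0]| == j]| =
  ('C(#|I|, j) * #|T|.-1 ^ j)%N.
Proof.
pose S (f : {ffun I -> T}) := [set i | f i != t0].
rewrite -card_draws -sum1_card -sum_nat_const.
(* Functions are grouped by their support [A], each group being a product family. *)
rewrite (partition_big S (mem [set A : {set I} | #|A| == j])) /= => [|f]; last by rewrite !inE.
apply: eq_bigr => A; rewrite inE => /eqP Aj; rewrite sum1dep_card.
pose R i : pred T := if i \in A then predC1 t0 else pred1 t0.
transitivity #|family R|.
  apply: eq_card => f; rewrite !inE; apply/andP/familyP => [[_ /eqP SA] i | fR].
    by rewrite /R -SA inE; case: ifPn; rewrite !inE // negbK.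
  suff SA : [set i | f i != t0] = A :> {set I} by rewrite /S SA Aj !eqxx.
  apply/setP => i; have := fR i; rewrite /R inE.
  by case: (i \in A); rewrite inE => ->.
rewrite card_family foldrE big_map big_enum /= -Aj -prod_nat_const [RHS]big_mkcond.
by apply: eq_bigr => i _; rewrite /R; case: (i \in A); rewrite ?cardC1 ?card1.
Qed.

(** The first [\rank A] rows of the invertible [row_ebase A] span [A]; the first [r] rows give
    [B]. *)
Lemma subspace_extension (F : fieldType) m n (A : 'M[F]_(m, n)) r :
  (\rank A <= r <= n)%N -> exists2 B : 'M[F]_(r, n), (A <= B)%MS & \rank B = r.
Proof.
move=> /andP[Ar rn]; exists (pid_mx r *m row_ebase A); last first.
  by rewrite mxrankMfree ?rank_pid_mx // row_free_unit row_ebase_unit.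
rewrite -{1}(mulmx_ebase A); apply/submxP.
exists (col_ebase A *m pid_mx (\rank A)).
by rewrite -!mulmxA (mulmxA (pid_mx _) (pid_mx _)) mul_pid_mx (minn_idPl Ar) (minn_idPr Ar).
Qed.

Lemma min_dist_unique (F : finFieldType) n (C : {vspace 'rV[F]_n}) d d' :
  min_dist C d -> min_dist C d' -> d = d'.
Proof.
move=> [[c [cC [c0 <-]]] dC] [[c' [cC' [c0' <-]]] dC'].
by apply/eqP; rewrite eqn_leq dC // dC'.
Qed.

(** * Weights and generalized weights read off the blocks of the message *)

Section ActiveBlocks.
Variables (F : finFieldType) (k u h : nat).
Local Notation q := #|F|.
Hypothesis huk : (h * u <= k)%N.

Local Notation block_incl := (block_incl F k u).

Definition active_blocks (a : 'rV[F]_k) : {set 'I_h} :=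
  [set i : 'I_h | a *m (block_incl i)^T != 0].

(** A message amounts to [h] vectors of [F^u] and [k - h * u] free coordinates. *)
Lemma card_active_blocks j :
  #|[set a | #|active_blocks a| == j]| =
  ('C(h, j) * (q ^ u - 1) ^ j * q ^ (k - h * u))%N.
Proof.
pose tail (t : 'I_(k - h * u)) : 'I_k := cast_ord (subnKC huk) (rshift (h * u) t).
pose f (a : 'rV[F]_k) : {ffun 'I_h -> 'rV[F]_u} * 'rV[F]_(k - h * u) :=
  ([ffun i : 'I_h => a *m (block_incl i)^T], \row_t a 0 (tail t)).
have f_inj : injective f.
  move=> a b [/ffunP Ef Er]; apply/rowP => l.
  have [lt_l | le_l] := ltnP l (h * u).
    have u0 : (0 < u)%N by case: (u) lt_l => //; rewrite muln0.
    have iP : (l %/ u < h)%N by rewrite ltn_divLR.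
    have tP : (l %% u < u)%N by rewrite ltn_mod.
    have := congr1 (fun v : 'rV_u => v 0 (Ordinal tP)) (Ef (Ordinal iP)).
    rewrite !ffunE !(mul_block_incl_tr huk).
    by have -> // : block_pos huk (Ordinal iP) (Ordinal tP) = l
      by apply: val_inj; rewrite /= -divn_eq.
  have tP : (l - h * u < k - h * u)%N by have := ltn_ord l; lia.
  have := congr1 (fun v : 'rV_(k - h * u) => v 0 (Ordinal tP)) Er; rewrite !mxE.
  by have -> // : tail (Ordinal tP) = l by apply: val_inj => /=; lia.
have f_bij : bijective f.
  apply: inj_card_bij => //.
  rewrite card_prod card_ffun !card_mx !mul1n card_ord -expnM -expnD.
  by rewrite [(u * h)%N]mulnC subnKC.
pose A := [set g : {ffun 'I_h -> 'rV[F]_u} | #|[set i | g i != 0]| == j].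
transitivity #|f @^-1: setX A setT|.
  apply: eq_card => a; rewrite !inE andbT; congr (_ == _).
  by apply: eq_card => i; rewrite !inE ffunE.
rewrite on_card_preimset; last exact: onW_bij.
by rewrite cardsX cardsT card_ffun_support !card_mx !mul1n card_ord subn1.
Qed.

(* The diagonal copy [E] of [F^u] in the sum of the blocks projects isomorphically
   onto each of them. *)
Lemma mixed_subspace_exists r : (0 < h)%N -> (r <= k)%N ->
  exists2 B : 'M[F]_(r, k), \rank B = r &
    forall i : 'I_h, (minn r u <= \rank (B *m (block_incl i)^T))%N.
Proof.
move=> h0 rk; pose E : 'M[F]_(u, k) := \sum_(i < h) block_incl i.
have EK (i : 'I_h) : E *m (block_incl i)^T = 1%:M.
  rewrite mulmx_suml (bigD1 i) //= block_inclK // big1 ?addr0 // => j ji.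
  exact: block_incl_orth.
(* Only the first [minn r u] rows of [E] are kept; extending them to rank [r] cannot lower the ranks
   on the blocks. *)
pose A : 'M[F]_(u, k) := pid_mx (minn r u) *m E.
have rA : \rank A = minn r u.
  apply/eqP; rewrite eqn_leq; apply/andP; split.
    by apply: leq_trans (mxrankM_maxl _ _) _; rewrite rank_pid_mx ?geq_minr.
  have := mxrankM_maxl A (block_incl (Ordinal h0))^T.
  by rewrite -mulmxA EK mulmx1 rank_pid_mx ?geq_minr.
have [|B AB rB] := subspace_extension (A := A) (r := r); first by rewrite rA geq_minl.
exists B => // i; apply: leq_trans (mxrankS (submxMr _ AB)).
by rewrite -mulmxA EK mulmx1 rank_pid_mx ?geq_minr.
Qed.

Section Code.
Variables (n : nat) (G : 'M[F]_(k, n)).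
Hypotheses (k0 : (0 < k)%N) (u0 : (0 < u)%N).
Hypothesis GU : forall j : 'I_n, (col j G)^T \in Uset F k u h.
Hypothesis Grep : forall v, v \in Uset F k u h ->
  exists! j : 'I_n, exists a : F, (col j G)^T = a *: v.

(** In the support count for the single row [a], each active block contributes [q ^ u - q ^ u.-1]
    and the others 0; then divide by [q - 1]. *)
Lemma wt_message (a : 'rV[F]_k) : a != 0 ->
  (wt (a *m G) + #|active_blocks a| * q ^ u.-1 = q ^ k.-1)%N.
Proof.
move=> a0; have q1 := card_finNzRing_gt1 F.
have gap e : (0 < e)%N -> (q ^ e - q ^ e.-1 = q.-1 * q ^ e.-1)%N.
  by case: e => // e _; rewrite expnS -{2}(mul1n (q ^ e)%N) -mulnBl subn1.
have := card_supp_subcode huk GU Grep a.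
rewrite rank_rV a0 subn1 gap // -wt_supp.
have -> : (\sum_(i < h) (q ^ u - q ^ (u - \rank (a *m (block_incl i)^T))) =
    q.-1 * (#|active_blocks a| * q ^ u.-1))%N.
  rewrite mulnCA -gap // -sum_nat_const [RHS]big_mkcond.
  apply: eq_bigr => i _; rewrite inE rank_rV.
  by case: eqP => _; rewrite /= ?subn0 ?subnn ?subn1.
by rewrite -mulnDr => /eqP; rewrite eqn_pmul2l ?ltn_predRL // => /eqP.
Qed.

Lemma card_rowcode_wt w : row_free G ->
  #|[set c | (c \in rowcode G) && (wt c == w)]| = #|[set a | wt (a *m G) == w]|.
Proof.
move=> /row_free_inj Ginj; rewrite -(card_imset _ (Ginj 1)); apply: eq_card => c.
rewrite inE mem_rowcode; apply/andP/imsetP => [[/submxP [a ->] w_c] | [a]].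
  by exists a; rewrite ?inE.
by rewrite inE => w_a ->; rewrite submxMl.
Qed.

(** One formula covers both ranges of [r], since [u - r] truncates to 0 beyond [u]. The lower bound
    uses that no block of [B] has rank above [r]. *)
Lemma ghw_rowcode r : row_free G -> (0 < h)%N -> (r <= k)%N ->
  is_ghw (rowcode G) r
    (((q ^ k - q ^ (k - r)) - h * (q ^ u - q ^ (u - r))) %/ (q - 1)).
Proof.
move=> Gfree h0 rk; have q1 := card_finNzRing_gt1 F.
have q0 : (0 < q.-1)%N by rewrite ltn_predRL.
rewrite subn1; split.
  have [B rB rBi] := mixed_subspace_exists h0 rk.
  exists (rowcode (B *m G)); rewrite rowcodeS submxMl dim_rowcode mxrankMfree //.
  do 2!split=> //; have := card_supp_subcode huk GU Grep B; rewrite rB => <-.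
  have -> : (\sum_(i < h) (q ^ u - q ^ (u - \rank (B *m (block_incl i)^T))) =
      h * (q ^ u - q ^ (u - r)))%N.
    rewrite -[X in (X * _)%N](card_ord h) -sum_nat_const; apply: eq_bigr => i _.
    (* The block rank is [minn r u], so both exponents agree, being 0 when [r >= u]. *)
    congr (_ - q ^ _)%N; have := rBi i; have := rank_leq_col (B *m (block_incl i)^T).
    by have := rank_leq_row (B *m (block_incl i)^T); lia.
  by rewrite addnK mulKn.
move=> D DG; have [M DM] := rowcode_onto D; move: DG.
rewrite {}DM rowcodeS dim_rowcode => /submxP [B ->]; rewrite mxrankMfree // => rB.
have := card_supp_subcode huk GU Grep B; rewrite rB => <-.
set S := (\sum_(i < h) _)%N.
have SP : (S <= h * (q ^ u - q ^ (u - r)))%N.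
  rewrite -[X in (_ <= X * _)%N](card_ord h) -sum_nat_const; apply: leq_sum => i _.
  rewrite leq_sub2l // leq_pexp2l ?(ltnW q1) // leq_sub2l // -rB.
  exact: mxrankM_maxl.
apply: (@leq_trans ((q.-1 * #|supp (rowcode (B *m G))|) %/ q.-1)); last by rewrite mulKn.
by apply: leq_div2r; rewrite leq_subLR addnC leq_add2r.
Qed.

End Code.
End ActiveBlocks.

Theorem theorem2p4 (F : finFieldType) (k u h n : nat) (G : 'M[F]_(k, n)) :
  let q := #|F| in
  (1 <= k)%N -> (1 <= h)%N -> (2 <= u)%N -> (h * u <= k)%N ->
  (h * (q ^ u - 1) < q ^ k - q ^ k.-1)%N ->
  (forall ih, is_ih q h ih ->
     (\sum_(1 <= i < (k - u).+1) h %/ q ^ i < ih + u)%N) ->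
  (* G : a k x |U|/(q-1) matrix with exactly one representative of each
     projective class of U as columns *)
  n = (#|Uset F k u h| %/ (q - 1))%N ->
  (forall j : 'I_n, (col j G)^T \in Uset F k u h) ->
  (forall v, v \in Uset F k u h ->
     exists! j : 'I_n, exists a : F, (col j G)^T = a *: v) ->
  let C1 := rowcode G in
  let d := (q ^ k.-1 - h * q ^ u.-1)%N in
  n = (((q ^ k - 1) - h * (q ^ u - 1)) %/ (q - 1))%N /\
  \dim C1 = k /\
  min_dist C1 d /\
  distance_optimal C1 /\
      (* (a) weight distribution *)
  [/\ #|[set c : 'rV[F]_n | (c \in C1) && (wt c == 0%N)]| = 1%N,
          #|[set c : 'rV[F]_n | (c \in C1) && (wt c == q ^ k.-1)%N]|
             = (q ^ (k - h * u) - 1)%N,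
          (forall j, (1 <= j <= h)%N ->
             #|[set c : 'rV[F]_n | (c \in C1) && (wt c == q ^ k.-1 - j * q ^ u.-1)%N]|
               = ('C(h, j) * (q ^ u - 1) ^ j * q ^ (k - h * u))%N) &
          (forall c, c \in C1 -> c != 0 ->
             wt c = (q ^ k.-1)%N \/
             exists2 j, (1 <= j <= h)%N & wt c = (q ^ k.-1 - j * q ^ u.-1)%N)] /\
      (* (b) generalized Hamming weights *)
      (forall r, (1 <= r <= u)%N ->
         is_ghw C1 r (((q ^ k - q ^ (k - r)) - h * (q ^ u - q ^ (u - r))) %/ (q - 1))) /\
      (forall r, (u <= r <= k)%N ->
         is_ghw C1 r (((q ^ k - q ^ (k - r)) - h * (q ^ u - 1)) %/ (q - 1))).
Proof.
move=> q k0 h0 u2 huk hq hih nE GU Grep C1 d.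
have q1 : (1 < q)%N := card_finNzRing_gt1 F.
have u0 : (0 < u)%N := ltnW u2.
have uk : (u <= k)%N by apply: leq_trans huk; apply: leq_pmull.
pose Q := (q ^ u.-1)%N; pose K := (q ^ k.-1)%N.
have Q0 : (0 < Q)%N by rewrite expn_gt0 ltnW.
(* Since [h <= h * Q], the left side of [hq] is at least [(q - 1) * (h * Q)], while its right side
   is [(q - 1) * K]. *)
have hQK : (h * Q < K)%N.
  move: hq; have -> : (q ^ k = q * K)%N by rewrite -expnS prednK.
  have -> : (q ^ u = q * Q)%N by rewrite -expnS prednK.
  by move: q1 Q0; rewrite -/K; clearbody q Q K; nia.
have K0 : (0 < K)%N by rewrite expn_gt0 ltnW.
have wt_eqE w m j : (j * Q <= K -> w + m * Q = K -> (w == K - j * Q) = (m == j))%N.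
  by move=> jK E; rewrite -(eqn_add2r (j * Q)) subnK // -E eqn_add2l eqn_pmul2r //.
have wtE (a : 'rV[F]_k) : a != 0 -> (wt (a *m G) + #|active_blocks u h a| * Q = K)%N.
  exact: wt_message.
have nb_le (a : 'rV[F]_k) : (#|active_blocks u h a| <= h)%N.
  by rewrite -[X in (_ <= X)%N]card_ord max_card.
have nb0 : #|active_blocks u h (0 : 'rV[F]_k)| = 0%N.
  by apply: eq_card0 => i; rewrite inE mul0mx eqxx.
have wt0 : wt (0 *m G) = 0%N.
  by rewrite mul0mx; apply: eq_card0 => j; rewrite inE mxE eqxx.
have wt_gt0 (a : 'rV[F]_k) : a != 0 -> (0 < wt (a *m G))%N.
  move=> a0; rewrite lt0n; apply: contraTneq hQK => w0.
  by rewrite -leqNgt -(wtE a a0) w0 leq_mul2r nb_le orbT.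
(* A nonzero message has a word of positive weight, so encoding is injective. *)
have Gfree : row_free G.
  rewrite -kermx_eq0; apply/rowV0P => a /sub_kermxP aG; apply/eqP.
  by apply: contraTT isT => /wt_gt0; rewrite aG -(mul0mx 1 G) wt0.
have dimC1 : \dim C1 = k by rewrite dim_rowcode; apply/eqP.
have mem_C1 c : c \in C1 -> exists a, c = a *m G.
  by rewrite mem_rowcode => /submxP.
have message0 (a : 'rV[F]_k) : a *m G != 0 -> a != 0.
  by apply: contraNneq => ->; rewrite mul0mx.
have min_dist_C1 : min_dist C1 d.
  split=> [|c /mem_C1 [a ->] /message0 /wtE E]; last first.
    by rewrite /d -/Q -/K leq_subLR -E addnC leq_add2r leq_mul2r nb_le orbT.
  (* The all-ones message has all [h] blocks active and attains [d]. *)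
  have a0 : const_mx 1 != 0 :> 'rV[F]_k.
    by apply/rV0Pn; exists (Ordinal k0); rewrite mxE oner_neq0.
  exists (const_mx 1 *m G); split; first by rewrite mem_rowcode submxMl.
  split; first by rewrite mulmx_free_eq0.
  have := wtE _ a0; have -> : active_blocks u h (const_mx 1 : 'rV[F]_k) = [set: 'I_h].
    apply/setP => i; rewrite !inE; apply/rV0Pn; exists (Ordinal u0).
    by rewrite (mul_block_incl_tr huk) mxE oner_neq0.
  by rewrite cardsT card_ord /d -/Q -/K => <-; rewrite addnK.
have UE := card_Uset F huk.
split; first by rewrite nE -UE addnK.
split=> //; split=> //; split.
  move=> d' dC1 [C' [dimC' dC']]; have dd' := min_dist_unique dC1 min_dist_C1.
  have [a ha qah] := is_ih_exists q1 h0.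
  have := griesmer dC'; rewrite dimC' dimC1 dd' leqNgt => /negP; apply.
  apply: (griesmer_sum_gt (a := a)) => //; first by rewrite u0.
  - suff E : K = (q ^ (k - u) * Q)%N by rewrite E ltn_pmul2r in hQK.
    by rewrite /K /Q -expnD; congr expn; clear - uk u0; lia.
  - exact: hih.
  have := UE; rewrite !subn1 !predn_exp mulnCA nE subn1 -/q => E.
  have q'0 : (0 < q.-1)%N by rewrite ltn_predRL.
  (* Exhibits [#|U|] as a multiple of [q - 1], so the quotient defining [n] is exact. *)
  have -> : #|Uset F k u h| = (q.-1 * (\sum_(i < k) q ^ i - h * \sum_(i < u) q ^ i))%N.
    by rewrite mulnBr -E addnK.
  rewrite mulKn // subnK // -(leq_pmul2l q'0) -E; lia.
split; last first.
  split=> r /andP[r1 r2]; first exact: ghw_rowcode (leq_trans r2 uk).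
  have E : (q ^ (u - r) = 1)%N by rewrite (eqP (r1 : u - r == 0)%N).
  by rewrite -[X in (q ^ u - X)%N]E; apply: ghw_rowcode.
have card_C1 w := card_rowcode_wt (G := G) w Gfree.
split.
- rewrite card_C1 (_ : [set a | _] = [set 0]) ?cards1 //.
  apply/setP => a; rewrite !inE; have [->|/wt_gt0] := eqVneq a 0; first by rewrite wt0.
  by case: wt.
(* Weight [K] means no active block; the zero message, also without any, accounts for the [- 1]. *)
- have := card_active_blocks F huk 0; rewrite bin0 expn0 !mul1n -/q => <-.
  rewrite card_C1 [in RHS](cardsD1 (0 : 'rV[F]_k)) inE nb0 add1n subn1 /=.
  apply: eq_card => a; rewrite !inE; have [->|/wtE E] := eqVneq a 0.
    by rewrite wt0 ltn_eqF.
  by have := wt_eqE _ _ 0%N isT E; rewrite mul0n subn0 => ->.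
- move=> j /andP[j1 jh]; rewrite -card_active_blocks // card_C1.
  (* Strictness keeps the target weight positive, which excludes the zero message. *)
  have jQK : (j * Q < K)%N by apply: leq_ltn_trans hQK; rewrite leq_mul2r jh orbT.
  apply: eq_card => a; rewrite !inE -/K -/Q; have [->|/wtE E] := eqVneq a 0.
    by rewrite wt0 nb0 !ltn_eqF ?subn_gt0.
  by rewrite (wt_eqE _ _ _ _ E) // ltnW.
move=> c /mem_C1 [a ->] /message0 /wtE E.
have [nb|nb] := posnP #|active_blocks u h a|; [left | right].
  by rewrite -/K -E nb addn0.
by exists #|active_blocks u h a|; [rewrite nb nb_le | rewrite -/K -/Q -E addnK].
Qed.
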